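(* For a Schubert union $S_U$ in $G(l,m)$, its geometric dual $D(S_U)$ and its grid-dual $S_{U^*}$ are equal (as subsets of $G(l,m)^*$).
   Context: Let $F$ be a field, $1\le l<m$ integers, $V$ an $m$-dimensional $F$-vector space with basis $e_1,\dots,e_m$, and $A_i=\mathrm{Span}(e_1,\dots,e_i)$. $G(l,m)$ is the Grassmann variety of $l$-dimensional subspaces of $V$. Let $G_{G(l,m)}=\{(b_1,\dots,b_l)\in\mathbf Z^l : 1\le b_1<\dots<b_l\le m\}$, partially ordered componentwise. For $\alpha=(a_1,\dots,a_l)\in G_{G(l,m)}$ let $S_\alpha=\{W\in G(l,m): \dim(W\cap A_{a_i})\ge i\ \forall i\}$ and $G_\alpha=\{\beta\in G_{G(l,m)}:\beta\le\alpha\}$. A Schubert union is a finite (possibly empty) union $S_U=\bigcup_i S_{\alpha_i}$; put $G_U=\bigcup_i G_{\alpha_i}$ and $H_U=G_{G(l,m)}\setminus G_U$. $G(l,m)^*$ is the Grassmann variety of $l$-dimensional subspaces of $V^*$. For a subspace $L\subset V$ put $L^\bot=\{h\in V^*: L\subset\ker h\}$. Schubert cycles and Schubert unions in $G(l,m)^*$ are taken with respect to the dual flag $0=A_m^\bot\subset A_{m-1}^\bot\subset\dots\subset A_1^\bot\subset V^*$ (so its $j$-dimensional member is $A_{m-j}^\bot$, with $A_0=0$), and have grids in $G_{G(l,m)^*}=\{(a_1,\dots,a_l):1\le a_1<\dots<a_l\le m\}$ defined in the same way. Geometric dual: for $M\subset G(l,m)$, $D(M)\subset G(l,m)^*$ is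 the set of $l$-dimensional subspaces $P\subset V^*$ whose common kernel $\bigcap_{h\in P}\ker h\subset V$ intersects every $l$-dimensional subspace $W\in M$ in more than $0$. Grid dual: let $rev:G_{G(l,m)}\to G_{G(l,m)^*}$, $rev(a_1,\dots,a_l)=(m+1-a_l,\dots,m+1-a_2,m+1-a_1)$. The grid dual of $S_U$ is the Schubert union $S_{U^*}\subset G(l,m)^*$ whose grid is $G_{U^*}=\{rev(\alpha):\alpha\in H_U\}$. *)

(* Defs.v *)
From HB Require Import structures.
From mathcomp Require Import all_boot all_order all_algebra.
From mathcomp Require Import zify.
From mathcomp Require Import boolp classical_sets.

Set Implicit Arguments.
Unset Strict Implicit.
Unset Printing Implicit Defensive.

Import GRing.Theory.
Local Open Scope ring_scope.

(* Positions and entries are both shifted to start from 0: [a : grid l m]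
   stands for the tuple (a_1, .., a_l) with a_(i+1) = (a i).+1. *)
Definition increasing (l m : nat) (f : {ffun 'I_l -> 'I_m}) : bool :=
  [forall i : 'I_l, forall j : 'I_l, (i < j)%N ==> (f i < f j)%N].

Record grid (l m : nat) : predArgType := Grid {
  grid_val :> {ffun 'I_l -> 'I_m};
  _ : increasing grid_val }.

HB.instance Definition _ l m := [isSub for @grid_val l m].
HB.instance Definition _ l m := [Finite of grid l m by <:].

Definition grid_le (l m : nat) (b a : grid l m) : bool :=
  [forall i : 'I_l, (b i <= a i)%N].

Definition grid_union (l m : nat) (U : {set grid l m}) : {set grid l m} :=
  \bigcup_(a in U) [set b | grid_le b a].

Fact rev_grid_subproof (l m : nat) (a : grid l m) :
  increasing [ffun i : 'I_l => rev_ord (a (rev_ord i))].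
Proof.
apply/forallP => i; apply/forallP => j; apply/implyP => lt_ij; rewrite !ffunE /=.
have lt_ji : (rev_ord j < rev_ord i)%N.
  by have /= := ltn_ord i; have /= := ltn_ord j; lia.
have /forallP/(_ (rev_ord j))/forallP/(_ (rev_ord i))/implyP/(_ lt_ji) := valP a.
by have := ltn_ord (a (rev_ord i)); have := ltn_ord (a (rev_ord j)) => /=; lia.
Qed.

(* In shifted entries, x |-> m + 1 - x becomes x |-> m - 1 - x, i.e. rev_ord. *)
Definition rev_grid (l m : nat) (a : grid l m) : grid l m :=
  Grid (rev_grid_subproof a).

Definition is_grid_dual (l m : nat) (U Ustar : {set grid l m}) : Prop :=
  grid_union Ustar = [set rev_grid a | a in ~: grid_union U].

Lemma rev_gridK (l m : nat) : involutive (@rev_grid l m).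
Proof. by move=> a; apply/val_inj/ffunP => i; rewrite !ffunE !rev_ordK. Qed.

Lemma grid_le_rev (l m : nat) (b a : grid l m) :
  grid_le (rev_grid b) (rev_grid a) = grid_le a b.
Proof.
apply/forallP/forallP => le_ab i; have := le_ab (rev_ord i); last first.
  by rewrite !ffunE /=; lia.
rewrite !ffunE !rev_ordK /=.
by have := ltn_ord (a i); have := ltn_ord (b i); lia.
Qed.

(* The complement of a grid is upward closed and rev_grid reverses the order,
   so the prescribed grid is indeed the grid of a union. *)
Lemma grid_dual_exists (l m : nat) (U : {set grid l m}) :
  is_grid_dual U [set rev_grid a | a in ~: grid_union U].
Proof.
apply/setP => b; apply/bigcupP/idP => [[c cH]|bH]; last first.
  by exists b => //; rewrite inE; apply/forallP.
rewrite inE => le_bc; case/imsetP: cH le_bc => a aH ->.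
rewrite -[b]rev_gridK grid_le_rev => le_ab; apply: imset_f.
move: aH; rewrite !inE; apply: contra => /bigcupP[u uU]; rewrite inE => le_bu.
apply/bigcupP; exists u => //; rewrite inE; apply/forallP => i.
exact: leq_trans (forallP le_ab i) (forallP le_bu i).
Qed.

Section Schubert.
Variables (F : fieldType) (V : vectType F).

Definition flag (m : nat) (e : m.-tuple V) (j : nat) : {vspace V} :=
  <<take j e>>%VS.

Definition schubert_cycle (l m : nat) (A : nat -> {vspace V}) (a : grid l m) :
    set {vspace V} :=
  [set W : {vspace V} | \dim W = l /\
    forall i : 'I_l, (i.+1 <= \dim (W :&: A (a i).+1))%N]%classic.

Definition schubert_union (l m : nat) (A : nat -> {vspace V})
    (U : {set grid l m}) : set {vspace V} :=
  (\bigcup_(a in [set` U]) schubert_cycle A a)%classic.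

End Schubert.

Lemma mem_bigcapv_seq (F : fieldType) (V : vectType F) (I : Type) (s : seq I)
    (f : I -> {vspace V}) (x : V) :
  (x \in (\bigcap_(i <- s) f i)%VS) = all (fun i => x \in f i) s.
Proof.
elim: s => [|i s IHs]; first by rewrite big_nil memvf.
by rewrite big_cons memv_cap IHs.
Qed.

Section Duality.
Variables (F : fieldType) (V : vectType F).

Definition annihilator (L : {vspace V}) : {vspace 'Hom(V, F^o)} :=
  (\bigcap_(v <- vbasis L) lker (linfun (fun h : 'Hom(V, F^o) => h v : F^o)))%VS.

Lemma mem_annihilator (L : {vspace V}) (h : 'Hom(V, F^o)) :
  (h \in annihilator L) = (L <= lker h)%VS.
Proof.
have evE v : linfun (fun g : 'Hom(V, F^o) => g v : F^o) h = h v.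
  have ev_lin : linear (fun g : 'Hom(V, F^o) => g v : F^o).
    by move=> k f g; rewrite add_lfunE scale_lfunE.
  pose ev := GRing.isLinear.Build F 'Hom(V, F^o) F^o *:%R _ ev_lin.
  pose evl : {linear 'Hom(V, F^o) -> F^o} :=
    HB.pack (fun g : 'Hom(V, F^o) => g v : F^o) ev.
  exact: (lfunE evl).
rewrite mem_bigcapv_seq; apply/allP/subvP => [hL v vL|hL v /vbasis_mem vL].
  rewrite (coord_vbasis vL); apply: rpred_sum => i _; apply: rpredZ.
  rewrite memv_ker -evE -memv_ker; apply: hL.
  by apply: mem_nth; rewrite size_tuple.
by rewrite memv_ker evE -memv_ker; apply: hL.
Qed.

Definition common_kernel (P : {vspace 'Hom(V, F^o)}) : {vspace V} :=
  (\bigcap_(h <- vbasis P) lker h)%VS.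

Lemma mem_common_kernel (P : {vspace 'Hom(V, F^o)}) (v : V) :
  reflect (forall h, h \in P -> h v = 0) (v \in common_kernel P).
Proof.
rewrite mem_bigcapv_seq; apply: (iffP allP) => [vP h hP|vP h /vbasis_mem hP].
  rewrite (coord_vbasis hP) sum_lfunE big1 // => i _; rewrite scale_lfunE.
  have /vP : (vbasis P)`_i \in vbasis P by apply: mem_nth; rewrite size_tuple.
  by rewrite memv_ker => /eqP->; rewrite scaler0.
by rewrite memv_ker vP.
Qed.

Definition dual_flag (m : nat) (A : nat -> {vspace V}) (j : nat) :
    {vspace 'Hom(V, F^o)} :=
  annihilator (A (m - j)%N).

Definition geometric_dual (l : nat) (M : set {vspace V}) :
    set {vspace 'Hom(V, F^o)} :=
  [set P : {vspace 'Hom(V, F^o)} | \dim P = l /\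
    forall W, M W -> (W :&: common_kernel P)%VS <> 0%VS]%classic.

End Duality.

(* Main.v *)
Require Import Defs.
From HB Require Import structures.
From mathcomp Require Import all_boot all_order all_algebra.
From mathcomp Require Import zify.
From mathcomp Require Import boolp classical_sets.

(** Write A_n for the n-th member of the flag and K for the common kernel of an
    l-dimensional P, so that K has codimension l. The dimensions of the K :&: A_n
    grow by 0 or 1 at each step. The l steps where they do not grow, the gaps of
    K, form a grid point t, and n - dim (K :&: A_n) is the number of entries of t
    below n. Whether P lies in either dual depends on t only.

    - For the grid dual: P is the annihilator of K, so P meets the annihilator of
      A_n in the annihilator of K + A_n, whose dimension is again determined by t.
      This makes rev t the jump sequence of P along the dual flag: P lies in the
      Schubert cycle of b iff rev t <= b ([schubert_dual_flag]). So P lies in the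
      grid dual iff rev t is in its grid, that is, iff t is not in the grid of U.
    - For the geometric dual: some W in the Schubert union of U meets K trivially
      iff t is in the grid of U. If such a W lies in the cycle of a, then
      dim (W :&: A_n) + dim (K :&: A_n) <= n bounds the entries of t by those of a
      ([gap_grid_le]). Conversely the span of the basis vectors indexed by t is a
      complement of K ([gaps_space_capv]) lying in every cycle of index a >= t
      ([gaps_space_schubert]).

    Since the complement of K is found among the coordinate subspaces rather than
    by a general-position choice, the argument is valid over finite fields. *)

Set Implicit Arguments.
Unset Strict Implicit.
Unset Printing Implicit Defensive.

Import GRing.Theory.
Local Open Scope ring_scope.

(** * Grids as subsets of the index set *)

Lemma card_set_ltn (l n : nat) : (n <= l)%N -> #|[set k : 'I_l | (k < n)%N]| = n.
Proof.
move=> le_nl; rewrite cardsE -sum1_card -[RHS]card_ord -sum1_card.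
by rewrite (big_ord_widen _ (fun=> 1%N) le_nl); apply: eq_bigl.
Qed.

Lemma grid_mono (l m : nat) (a : grid l m) (i j : 'I_l) :
  (i < j)%N -> (a i < a j)%N.
Proof.
by have /forallP/(_ i)/forallP/(_ j)/implyP := valP a; apply.
Qed.

Lemma grid_inj (l m : nat) (a : grid l m) : injective a.
Proof.
move=> i j eq_a; apply/val_inj.
by case: (ltngtP i j) => // /(grid_mono a); rewrite eq_a ltnn.
Qed.

(** The positions holding entries below n form an initial segment. This turns
    bounds on single entries into bounds on counting functions, the form in which
    dimensions appear. *)
Lemma grid_rank (l m : nat) (a : grid l m) (n : nat) (i : 'I_l) :
  (i < #|[set k | (a k < n)%N]|)%N = (a i < n)%N.
Proof.
apply/idP/idP => [|lt_an]; last first.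
  rewrite -{1}(card_set_ltn (ltn_ord i)).
  apply/subset_leq_card/fintype.subsetP => k.
  rewrite !inE ltnS leq_eqVlt => /orP[/eqP/val_inj-> //|/(grid_mono a)/ltn_trans].
  exact.
apply: contraLR; rewrite -!leqNgt => le_na.
rewrite -[leqRHS](card_set_ltn (ltnW (ltn_ord i))).
apply/subset_leq_card/fintype.subsetP => k; rewrite !inE => lt_ak; rewrite ltnNge.
apply: contraL (leq_trans lt_ak le_na); rewrite -leqNgt leq_eqVlt.
by case/orP => [/eqP/val_inj->|/(grid_mono a)/ltnW].
Qed.

Lemma exists_grid (l m : nat) (T : {set 'I_m}) :
  #|T| = l -> exists t : grid l m, t @: [set: 'I_l] = T.
Proof.
move=> cardT; pose f := [ffun i : 'I_l => enum_val (cast_ord (esym cardT) i)].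
have f_incr : increasing f.
  apply/forallP => i; apply/forallP => j; apply/implyP => lt_ij; rewrite !ffunE.
  have x0 : 'I_m := enum_val (cast_ord (esym cardT) i).
  have srt : sorted ltn (map val (enum T)).
    rewrite {1}/(enum _) -enumT.
    apply: (subseq_sorted ltn_trans (map_subseq val (filter_subseq _ _))).
    by rewrite val_enum_ord iota_ltn_sorted.
  rewrite !(enum_val_nth x0) /= -!(nth_map x0 0%N val) -?cardE ?cardT //.
  by apply: (sorted_ltn_nth ltn_trans) => //; rewrite inE size_map -cardE cardT.
exists (Grid f_incr); apply/eqP; rewrite eqEcard; apply/andP; split.
  by apply/fintype.subsetP => _ /imsetP[i _ ->]; rewrite /= ffunE enum_valP.
by rewrite (card_imset _ (@grid_inj _ _ (Grid f_incr))) cardsT card_ord cardT.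
Qed.

(** Counts over a set of indices and over the positions of the grid point that
    enumerates it agree, which allows [grid_rank] to be used on dimensions of
    coordinate subspaces. *)
Lemma card_grid_image (l m : nat) (t : grid l m) (T : {set 'I_m}) (n : nat) :
  t @: [set: 'I_l] = T ->
  #|[set j in T | (j < n)%N]| = #|[set k | (t k < n)%N]|.
Proof.
move=> <-; rewrite -(card_imset _ (@grid_inj _ _ t)); apply: eq_card => j.
rewrite !inE; apply/andP/imsetP => [[/imsetP[k _ ->] lt_n]|[k]].
  by exists k; rewrite ?inE.
by rewrite inE => lt_n ->; split; first exact: imset_f.
Qed.

Lemma mem_grid_union (l m : nat) (U : {set grid l m}) (b : grid l m) :
  reflect (exists2 a, a \in U & grid_le b a) (b \in grid_union U).
Proof.
by apply: (iffP bigcupP) => -[a aU]; rewrite ?inE => le_ba; exists a; rewrite ?inE.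
Qed.

(** * Annihilators *)

Section Annihilator.
Variables (F : fieldType) (V : vectType F).
Implicit Types (L : {vspace V}) (P : {vspace 'Hom(V, F^o)}).

(** Restriction of functionals to L is onto the dual of L, since a functional on
    L extends along a projection, and its kernel is the annihilator. *)
Lemma dim_annihilator L : (\dim (annihilator L) + \dim L = \dim {:V})%N.
Proof.
pose res (h : 'Hom(V, F^o)) : 'Hom(subvs_of L, F^o) := (h \o linfun vsval)%VF.
have res_lin : linear res.
  by move=> k f g; rewrite /res comp_lfunDl -comp_lfunZl.
pose resL : {linear 'Hom(V, F^o) -> 'Hom(subvs_of L, F^o)} :=
  HB.pack res (GRing.isLinear.Build F _ _ *:%R res res_lin).
have resE h : linfun resL h = res h by rewrite lfunE.
have ker_res : lker (linfun resL) = annihilator L.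
  apply/vspaceP => h; rewrite memv_ker resE mem_annihilator.
  apply/eqP/subvP => [h0 v vL|hL].
    have := congr1 (fun g : 'Hom(_, _) => g (vsproj L v)) h0.
    by rewrite comp_lfunE lfunE /= vsprojK // zero_lfunE memv_ker => ->.
  apply/lfunP => w; rewrite comp_lfunE lfunE /= zero_lfunE; apply/eqP.
  by rewrite -memv_ker hL ?subvsP.
have im_res : limg (linfun resL) = fullv.
  apply/eqP; rewrite eqEsubv subvf; apply/subvP => g _.
  apply/memv_imgP; exists (g \o linfun (vsproj L))%VF; rewrite ?memvf // resE.
  by apply/lfunP => w; rewrite !comp_lfunE !lfunE /= vsvalK.
have := limg_ker_dim (linfun resL) fullv.
by rewrite capfv ker_res im_res !dimvf /= /dim /= !muln1.
Qed.

Lemma annihilatorD L1 L2 :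
  annihilator (L1 + L2)%VS = (annihilator L1 :&: annihilator L2)%VS.
Proof. by apply/vspaceP => h; rewrite memv_cap !mem_annihilator subv_add. Qed.

(** The common kernel is cut out by the dim P equations of a basis of P. *)
Lemma dim_common_kernel_ge P : (\dim {:V} <= \dim (common_kernel P) + \dim P)%N.
Proof.
pose ev (v : V) : 'rV[F]_(\dim P) := \row_i (vbasis P)`_i v.
have ev_lin : linear ev.
  by move=> k u v; apply/rowP => i; rewrite !mxE linearP.
pose evL : {linear V -> 'rV[F]_(\dim P)} :=
  HB.pack ev (GRing.isLinear.Build F _ _ *:%R ev ev_lin).
have ker_ev : lker (linfun evL) = common_kernel P.
  apply/vspaceP => v; rewrite memv_ker lfunE /= mem_bigcapv_seq.
  apply/eqP/allP => [ev0 h|hv].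
    case/(nthP 0) => i; rewrite size_tuple => lt_i <-; rewrite memv_ker.
    by have /rowP/(_ (Ordinal lt_i)) := ev0; rewrite !mxE /= => ->.
  apply/rowP => i; rewrite !mxE.
  have /hv : (vbasis P)`_i \in vbasis P by rewrite mem_nth ?size_tuple.
  by rewrite memv_ker => /eqP.
rewrite -(limg_ker_dim (linfun evL) fullv) capfv ker_ev leq_add2l.
by apply: leq_trans (dimvS (subvf _)) _; rewrite dimvf dim_matrix [leqLHS]mul1n.
Qed.

(** P is clearly contained in the annihilator of its common kernel, whose
    dimension is at most dim P because dim P equations cut out a kernel of
    codimension at most dim P. *)
Lemma common_kernelK P : annihilator (common_kernel P) = P.
Proof.
apply/esym/eqP; rewrite eqEdim; apply/andP; split.
  apply/subvP => h hP; rewrite mem_annihilator.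
  apply/subvP => v /mem_common_kernel vP.
  by rewrite memv_ker vP.
rewrite -(leq_add2r (\dim (common_kernel P))) dim_annihilator addnC.
exact: dim_common_kernel_ge.
Qed.

End Annihilator.

(** * Coordinate subspaces and the flag *)

Section Flag.
Variables (F : fieldType) (V : vectType F) (m : nat) (e : m.-tuple V).
Hypothesis he : basis_of (fullv : {vspace V}) e.
Implicit Types (S : {set 'I_m}) (K W : {vspace V}).

Definition coordinate_space S : {vspace V} :=
  <<[seq e`_i | i : 'I_m <- enum S]>>%VS.

Lemma dim_coordinate_space S : \dim (coordinate_space S) = #|S|.
Proof.
have free_e := basis_free he; have uniq_e := free_uniq free_e.
have uniq_S : uniq [seq e`_i | i : 'I_m <- enum S].
  rewrite map_inj_uniq ?enum_uniq // => i j /eqP.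
  by rewrite nth_uniq ?size_tuple // => /eqP/val_inj.
suff /eqP-> : free [seq e`_i | i : 'I_m <- enum S] by rewrite size_map -cardE.
have eq_filter : perm_eq [seq x <- e | x \in [seq e`_i | i : 'I_m <- enum S]]
                         [seq e`_i | i : 'I_m <- enum S].
  apply: uniq_perm; rewrite ?filter_uniq // => x; rewrite mem_filter andb_idr //.
  by case/mapP => i _ ->; rewrite mem_nth ?size_tuple.
by rewrite -(perm_free eq_filter) filter_free.
Qed.

Lemma coordinate_spaceS S1 S2 :
  S1 \subset S2 -> (coordinate_space S1 <= coordinate_space S2)%VS.
Proof.
move=> /fintype.subsetP sub12; apply: sub_span => _ /mapP[i iS1 ->].
by apply: map_f; rewrite mem_enum sub12 // -mem_enum.
Qed.

Lemma coordinate_spaceU S1 S2 :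
  (coordinate_space S1 + coordinate_space S2)%VS = coordinate_space (S1 :|: S2).
Proof.
rewrite -span_cat; apply: eq_span => x; rewrite mem_cat.
apply/orP/mapP => [[]/mapP[i]|[i]]; rewrite !mem_enum.
- by move=> iS ->; exists i; rewrite // mem_enum inE iS.
- by move=> iS ->; exists i; rewrite // mem_enum inE iS orbT.
by rewrite inE => /orP[] iS ->; [left|right]; apply: map_f; rewrite mem_enum.
Qed.

(** One inclusion is clear, and the dimensions agree by inclusion-exclusion on
    both sides. *)
Lemma coordinate_spaceI S1 S2 :
  (coordinate_space S1 :&: coordinate_space S2)%VS = coordinate_space (S1 :&: S2).
Proof.
apply/esym/eqP; rewrite eqEdim subv_cap.
rewrite !coordinate_spaceS ?subsetIl ?subsetIr //=.
rewrite -(leq_add2l (\dim (coordinate_space S1 + coordinate_space S2)%VS)).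
by rewrite dimv_sum_cap coordinate_spaceU !dim_coordinate_space cardsUI.
Qed.

Lemma flagE n : flag e n = coordinate_space [set i : 'I_m | (i < n)%N].
Proof.
apply: eq_span => x; apply/(nthP 0)/mapP => [[i]|[i]]; rewrite ?mem_enum ?inE.
  rewrite size_take_min leq_min size_tuple => /andP[lt_in lt_im] <-.
  by exists (Ordinal lt_im); rewrite ?mem_enum ?inE ?nth_take.
move=> lt_in ->; exists i; rewrite ?nth_take //.
by rewrite size_take_min leq_min size_tuple lt_in /=.
Qed.

Lemma dim_flag n : (n <= m)%N -> \dim (flag e n) = n.
Proof. by move=> le_nm; rewrite flagE dim_coordinate_space card_set_ltn. Qed.

Lemma flagS n : (flag e n <= flag e n.+1)%VS.
Proof.
rewrite !flagE coordinate_spaceS //.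
by apply/fintype.subsetP => i; rewrite !inE => /ltnW.
Qed.

(** * Gaps of a subspace along the flag *)

(** The index j counts from 0, so j stands for the step from A_j to A_(j+1). *)
Definition gaps K : {set 'I_m} :=
  [set j : 'I_m | \dim (K :&: flag e j.+1) == \dim (K :&: flag e j)].

Lemma dim_cap_flagS K n : (n < m)%N ->
  (\dim (K :&: flag e n) <= \dim (K :&: flag e n.+1)
     <= (\dim (K :&: flag e n)).+1)%N.
Proof.
move=> lt_nm; rewrite dimvS ?capvS ?flagS //=.
have := dimv_sum_cap (K :&: flag e n.+1) (flag e n).
rewrite -capvA (capv_idPr (flagS n)) (dim_flag (ltnW lt_nm)).
have : (\dim (K :&: flag e n.+1 + flag e n) <= n.+1)%N.
  by rewrite -[leqRHS](dim_flag lt_nm) dimvS // subv_add capvSr flagS.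
lia.
Qed.

Lemma dim_cap_flag K n : (n <= m)%N ->
  (\dim (K :&: flag e n) + #|[set j in gaps K | (j < n)%N]| = n)%N.
Proof.
elim: n => [_|n IHn lt_nm].
  rewrite (eq_card0 (A := [set j in _ | _])) => [|j].
    by apply/eqP; rewrite addn0 -leqn0 -{2}(dim_flag (leq0n m)) dimvS ?capvSr.
  by rewrite inE ltn0 andbF.
have {IHn} := IHn (ltnW lt_nm); have := dim_cap_flagS K lt_nm.
pose k := Ordinal lt_nm.
have -> : #|[set j in gaps K | (j < n.+1)%N]|
         = ((k \in gaps K) + #|[set j in gaps K | (j < n)%N]|)%N.
  rewrite (cardsD1 k) inE /= ltnSn andbT; congr (_ + _)%N; apply: eq_card => j.
  by rewrite !inE -val_eqE /= ltnS [(j < n)%N]ltn_neqAle andbCA.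
by rewrite inE /=; case: eqP => /=; lia.
Qed.

(** The intersection vanishes inside each flag member, by induction: at a gap of
    K the space K :&: A_(n+1) is already K :&: A_n, and at any other step the
    coordinate space has no new basis vector in A_(n+1). *)
Lemma gaps_space_capv K : (coordinate_space (gaps K) :&: K)%VS = 0%VS.
Proof.
have flag_full : flag e m = fullv.
  by rewrite /flag take_oversize ?size_tuple // (span_basis he).
suff cap0 n : (n <= m)%N ->
    (coordinate_space (gaps K) :&: K :&: flag e n)%VS = 0%VS.
  by rewrite -(cap0 m) // flag_full capvf.
elim: n => [_|n IHn lt_nm].
  by rewrite /flag take0 span_nil capv0.
have := IHn (ltnW lt_nm); case: (boolP (Ordinal lt_nm \in gaps K)) => k_gap <-.
  rewrite -!capvA; congr (_ :&: _)%VS; apply/esym/eqP; rewrite eqEdim.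
  by move: k_gap; rewrite inE /= => /eqP->; rewrite leqnn andbT capvS ?flagS.
rewrite -!capvA ![(K :&: _)%VS]capvC !capvA; congr (_ :&: _)%VS.
rewrite !flagE !coordinate_spaceI; congr coordinate_space; apply/setP => j.
rewrite !inE ltnS [(j < n)%N]ltn_neqAle.
have [eq_jn|//] := eqVneq (j : nat) n; rewrite andbF.
have -> : j = Ordinal lt_nm by apply/val_inj.
by move: k_gap; rewrite inE => /negbTE->.
Qed.

Lemma exists_gap_grid l K : (\dim K + l = m)%N ->
  exists2 t : grid l m, t @: [set: 'I_l] = gaps K &
    forall n, (n <= m)%N ->
      (\dim (K :&: flag e n) + #|[set k | (t k < n)%N]| = n)%N.
Proof.
move=> dimK; have card_gaps : #|gaps K| = l.
  have := dim_cap_flag K (leqnn m).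
  rewrite (capv_idPl _); last first.
    by rewrite /flag take_oversize ?size_tuple // (span_basis he) subvf.
  rewrite (eq_card (B := gaps K)) => [|j]; last by rewrite inE ltn_ord andbT.
  by move: dimK; lia.
have [t im_t] := exists_grid card_gaps; exists t => // n le_nm.
by rewrite -(card_grid_image _ im_t) dim_cap_flag.
Qed.

Section Codimension.
Variables (l : nat) (K : {vspace V}) (t : grid l m).
Hypothesis im_t : t @: [set: 'I_l] = gaps K.
Hypothesis dimKE : forall n, (n <= m)%N ->
  (\dim (K :&: flag e n) + #|[set k | (t k < n)%N]| = n)%N.

(** If W and K are in direct sum, so are their traces on A_n with n = a_i + 1. The
    trace of W there has dimension at least i + 1, so at most n - (i + 1)
    dimensions remain for K, which forces at least i + 1 gaps of K below n. *)
Lemma gap_grid_le (a : grid l m) W :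
  schubert_cycle (flag e) a W -> (W :&: K = 0)%VS -> grid_le t a.
Proof.
case=> _ Wa WK0; apply/forallP => i; rewrite -ltnS -(grid_rank t).
rewrite -(leq_add2l (\dim (K :&: flag e (a i).+1))) dimKE ?ltn_ord //.
apply: leq_trans (leq_add (leqnn _) (Wa i)) _.
rewrite -dimv_disjoint_sum.
  by rewrite -[leqRHS](dim_flag (ltn_ord (a i))) dimvS // subv_add !capvSr.
by apply/eqP; rewrite -subv0 -WK0 capvC capvS ?capvSl.
Qed.

Lemma gaps_space_schubert (a : grid l m) :
  grid_le t a -> schubert_cycle (flag e) a (coordinate_space (gaps K)).
Proof.
move=> /forallP le_ta; split=> [|i].
  rewrite dim_coordinate_space -im_t card_imset ?cardsT ?card_ord //.
  exact: grid_inj.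
rewrite flagE coordinate_spaceI dim_coordinate_space -setIdE.
by rewrite (card_grid_image _ im_t) grid_rank ltnS.
Qed.

(** Since P is the annihilator of K, the space P :&: annihilator A_n has dimension
    l - #{k | t_k < n}. With n = m - (b_i + 1) this is at least i + 1 exactly when
    at most l - 1 - i entries of t are below n, i.e. when the entry of t at the
    reversed position is at least n. *)
Lemma schubert_dual_flag (P : {vspace 'Hom(V, F^o)}) (b : grid l m) :
  \dim P = l -> K = common_kernel P ->
  schubert_cycle (dual_flag m (flag e)) b P <-> grid_le (rev_grid t) b.
Proof.
move=> dimP defK.
have dimV : \dim {:V} = m by rewrite (size_basis he).
have dim_cap n : (n <= m)%N ->
    (\dim (P :&: annihilator (flag e n)) + #|[set k | (t k < n)%N]| = l)%N.
  move=> le_nm; have := dim_annihilator (K + flag e n)%VS.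
  have := dimv_sum_cap K (flag e n); have := dim_annihilator K.
  have := dimKE le_nm.
  by rewrite annihilatorD defK common_kernelK dimP dimV dim_flag //; lia.
suff cyc_i (i : 'I_l) : (i.+1 <= \dim (P :&: dual_flag m (flag e) (b i).+1))%N
    = (rev_grid t i <= b i)%N.
  split=> [[_ Pb]|/forallP le_tb]; first by apply/forallP => i; rewrite -cyc_i.
  by split=> // i; rewrite cyc_i.
have := dim_cap _ (leq_subr (b i).+1 m).
have := grid_rank t (m - (b i).+1) (rev_ord i).
rewrite /dual_flag ffunE /=.
have := ltn_ord i; have := ltn_ord (b i); have := ltn_ord (t (rev_ord i)).
by lia.
Qed.

End Codimension.
End Flag.

(** * The two duals *)

Theorem theorem2p15 (F : fieldType) (l m : nat) (hl : (1 <= l)%N)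
    (hlm : (l < m)%N) (V : vectType F) (e : m.-tuple V)
    (he : basis_of (fullv : {vspace V}) e)
    (U Ustar : {set grid l m}) (hU : is_grid_dual U Ustar) :
  geometric_dual l (schubert_union (flag e) U) =
  schubert_union (dual_flag m (flag e)) Ustar.
Proof.
have gap_grid (P : {vspace 'Hom(V, F^o)}) : \dim P = l ->
    exists2 t : grid l m, t @: [set: 'I_l] = gaps e (common_kernel P) &
    forall n, (n <= m)%N ->
      (\dim (common_kernel P :&: flag e n) + #|[set k | (t k < n)%N]| = n)%N.
  move=> dimP; apply: exists_gap_grid => //; rewrite addnC -dimP.
  by rewrite -{1}(common_kernelK P) dim_annihilator (size_basis he).
have mem_dual (t : grid l m) :
    (rev_grid t \in grid_union Ustar) = (t \notin grid_union U).
  by rewrite hU (mem_imset _ _ (can_inj (@rev_gridK l m))) inE.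
apply/seteqP; split=> P.
  case=> dimP PU; have [t im_t dimKE] := gap_grid P dimP.
  have : rev_grid t \in grid_union Ustar.
    rewrite mem_dual; apply/mem_grid_union => -[a aU le_ta].
    apply: (PU (coordinate_space e (gaps e (common_kernel P)))).
      by exists a; last exact: gaps_space_schubert le_ta.
    exact: gaps_space_capv.
  case/mem_grid_union => b bU le_tb; exists b => //.
  exact/(schubert_dual_flag he dimKE _ dimP erefl).
case=> b bU Pb; have dimP := Pb.1; have [t im_t dimKE] := gap_grid P dimP.
split=> // W [a aU Wa] WK0.
have : rev_grid t \in grid_union Ustar.
  apply/mem_grid_union; exists b => //.
  exact/(schubert_dual_flag he dimKE _ dimP erefl).
rewrite mem_dual => /mem_grid_union[]; exists a => //.
exact: (gap_grid_le he dimKE Wa WK0).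
Qed.
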